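(* Let $\kappa\ge\omega$ and let $\mathcal{U}$ be a ground-model non-principal ultrafilter on $\omega$ such that $\Vdash_{\mathbb{M}_\kappa}$ ``$\dot{\mu}_{\mathcal{U}}$ is a P-measure''. Then $\mathcal{U}$ is a P-point in $V$.
   Context: $\lambda_\kappa$ is the standard product probability measure on $2^\kappa$, and $\mathbb{M}_\kappa=\mathrm{Bor}(2^\kappa)/\{\lambda_\kappa\text{-null sets}\}$ (forcing with its non-zero elements). For $M\in\mathbb{M}_\kappa^\omega$ let $\dot M=\{\langle k,M(k)\rangle:k\in\omega\}$; every name for a subset of $\omega$ is forced equal to such a $\dot M$. Let $\dot r$ be the name for the generic element of $2^\kappa$. For $M\in\mathbb{M}_\kappa^\omega$ let $\mu_M(B)=\lim_{k\to\mathcal{U}}\lambda_\kappa(M(k)\wedge B)$, a $\sigma$-additive Borel measure on $2^\kappa$ absolutely continuous w.r.t. $\lambda_\kappa$, with Radon–Nikodym derivative $f_M$. $\dot\mu_\mathcal{U}$ is the name for the function on $\wp(\omega)$ with $\Vdash\dot\mu_\mathcal{U}(\dot M)=f_M(\dot r)$ (the Solovay measure, forced to be a finitely additive probability measure on $\omega$). A P-measure is a finitely additive probability measure on $\omega$ vanishing on points such that for every decreasing sequence $(E_n)$ of infinite subsets of $\omega$ there is $E\subseteq\omega$ with $E\setminus E_n$ finite for all $n$ and $\mu(E)=\lim_n\mu(E_n)$. A P-point is a non-principal ultrafilter every countable subfamily of which has a pseudointersection in it. *)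

(* Defs.v *)
From HB Require Import structures.
From mathcomp Require Import all_boot all_order all_algebra.
From mathcomp Require Import finmap.
From mathcomp Require Import generic_quotient lra.
From mathcomp Require Import all_classical all_reals all_analysis.
From mathcomp Require Import measurable_realfun.
Import Order.TTheory GRing.Theory Num.Theory.
Import numFieldNormedType.Exports.

Set Implicit Arguments.
Unset Strict Implicit.
Unset Printing Implicit Defensive.

Local Open Scope classical_set_scope.
Local Open Scope ring_scope.

Definition nonprincipal (U : set_system nat) := forall n : nat, ~ U [set n].

Definition pseudointersection (C : set (set nat)) (A : set nat) :=
  forall X, C X -> finite_set (A `\` X).

Definition P_point (U : set_system nat) :=
  [/\ UltraFilter U, nonprincipal U &
    forall C : set (set nat), C `<=` U -> countable C ->
      exists2 A, U A & pseudointersection C A].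

Definition two_pow (K : Type) : Type := prod_topology (fun _ : K => bool).

HB.instance Definition _ (K : Type) := Pointed.on (two_pow K).
HB.instance Definition _ (K : Type) := Topological.on (two_pow K).

Definition borel_two_pow (K : Type) :=
  g_sigma_algebraType (@open (two_pow K)).

(* For uncountable K the Borel sigma-algebra of 2^K is strictly larger than the
   product sigma-algebra, so the values on basic clopen sets alone do not pin
   down a Borel measure; together with outer regularity they do, since 2^K is
   compact and zero-dimensional. *)
Definition standard_product_measure (R : realType) (K : choiceType)
    (lam : probability (borel_two_pow K) R) :=
  (forall (J : {fset K}) (s : K -> bool),
     lam [set x | forall i, i \in J -> x i = s i]
       = ((2^-1 : R) ^+ #|` J |)%:E) /\
  (forall B, measurable B ->
     lam B = ereal_inf [set lam O | O in [set O : set (two_pow K) |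
                                          open O /\ B `<=` O]]).

Section measure_algebra.
Context d (T : measurableType d) (R : realType) (P : probability T R).

Definition null_eq (A B : set_type (@measurable d T)) :=
  `[< P (val A `+` val B) = 0%E >].

Let mval (A : set_type (@measurable d T)) : measurable (val A).
Proof. by case: A => A /= /set_mem. Qed.

Let null_sub (A B : set T) : measurable A -> measurable B -> A `<=` B ->
  P B = 0%E -> P A = 0%E.
Proof. by move=> mA mB AB B0; exact: (subset_measure0 mA mB AB B0). Qed.

Lemma null_eq_refl : reflexive null_eq.
Proof. by move=> A; apply/asboolP; rewrite setYK measure0. Qed.

Lemma null_eq_sym : symmetric null_eq.
Proof. by move=> A B; rewrite /null_eq setYC. Qed.

Lemma null_eq_trans : transitive null_eq.
Proof.
move=> B A C /asboolP AB /asboolP BC; apply/asboolP.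
have mA := mval A; have mB := mval B; have mC := mval C.
have mAB : measurable (val A `+` val B).
  by rewrite setY_def; apply: measurableU; exact: measurableD.
have mBC : measurable (val B `+` val C).
  by rewrite setY_def; apply: measurableU; exact: measurableD.
have mAC : measurable (val A `+` val C).
  by rewrite setY_def; apply: measurableU; exact: measurableD.
apply: (null_sub mAC (measurableU _ _ mAB mBC)); last first.
  exact: null_set_setU.
move=> x; rewrite !setY_def => -[[Ax Cx]|[Cx Ax]].
  by have [Bx|Bx] := pselect (val B x); [right; left|left; left].
by have [Bx|Bx] := pselect (val B x); [left; right|right; right].
Qed.

Canonical null_eq_equiv := EquivRel null_eq null_eq_refl null_eq_sym null_eq_trans.

Definition malg : Type := {eq_quot null_eq}%qT.
HB.instance Definition _ := Choice.on malg.
HB.instance Definition _ := EqQuotient.on malg.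

(* A Borel representative of an element of the measure algebra; everything below
   depends on it only up to a null set. *)
Definition rep (a : malg) : set T := val (repr a).

Lemma measurable_rep a : measurable (rep a).
Proof. exact: mval. Qed.

Definition malg_class (A : set T) (mA : measurable A) : malg :=
  (\pi_malg (exist _ A (mem_set mA)))%qT.

Lemma rep_class A (mA : measurable A) : P (rep (malg_class mA) `+` A) = 0%E.
Proof.
rewrite /rep /malg_class.
set a : set_type (@measurable d T) := exist _ A (mem_set mA).
have : (repr (\pi_malg a) == a %[mod malg])%qT by rewrite reprK.
by rewrite eqmodE /= => /asboolP.
Qed.

Definition malg0 : malg := malg_class measurable0.

Definition malg_le (a b : malg) := P (rep a `\` rep b) = 0%E.

Lemma malg_le_class A B (mA : measurable A) (mB : measurable B) :
  malg_le (malg_class mA) (malg_class mB) <-> P (A `\` B) = 0%E.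
Proof.
rewrite /malg_le; set A' := rep _; set B' := rep _.
have A'A : P (A' `+` A) = 0%E := rep_class mA.
have B'B : P (B' `+` B) = 0%E := rep_class mB.
have mA' : measurable A' := measurable_rep _.
have mB' : measurable B' := measurable_rep _.
have mY (X Y : set T) : measurable X -> measurable Y -> measurable (X `+` Y).
  by move=> mX mZ; rewrite setY_def; apply: measurableU; exact: measurableD.
have key (X Y X' Y' : set T) : measurable X -> measurable Y ->
    measurable X' -> measurable Y' -> P (X `+` X') = 0%E ->
    P (Y `+` Y') = 0%E -> P (X `\` Y) = 0%E -> P (X' `\` Y') = 0%E.
  move=> mX mZ mX' mZ' X0 Y0 XY0.
  have mXY := measurableD mX mZ.
  apply: (null_sub (measurableD mX' mZ') (measurableU _ _
     (measurableU _ _ (mY _ _ mX mX') (mY _ _ mZ mZ')) mXY)); last first.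
    apply: null_set_setU => //; first exact: measurableU (mY _ _ _ _) (mY _ _ _ _).
    exact: null_set_setU (mY _ _ _ _) (mY _ _ _ _) _ _.
  move=> x [X'x Y'x]; rewrite !setY_def.
  have [Xx|Xx] := pselect (X x); last by left; left; right.
  by have [Yx|Yx] := pselect (Y x); [left; right; left|right].
split; first exact: key.
by apply: key => //; rewrite setYC.
Qed.

End measure_algebra.

Section forcing.
Context d (T : measurableType d) (R : realType) (P : probability T R).

Definition condition := {a : malg P | a != malg0 P}.

Definition cond_le (q p : condition) := malg_le (val q) (val p).

(* A sentence of the forcing language is identified with the set of conditions
   forcing it; the connectives are the usual clauses of the forcing relation. *)
Definition sentence := condition -> Prop.

Definition fand (phi psi : sentence) : sentence := fun p => phi p /\ psi p.

Definition for_ (phi psi : sentence) : sentence := fun p =>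
  forall q, cond_le q p -> exists2 r, cond_le r q & phi r \/ psi r.

Definition fnot (phi : sentence) : sentence := fun p =>
  forall q, cond_le q p -> ~ phi q.

Definition fimp (phi psi : sentence) : sentence := fun p =>
  forall q, cond_le q p -> phi q -> psi q.

Definition fiff (phi psi : sentence) : sentence :=
  fand (fimp phi psi) (fimp psi phi).

Definition fall (X : Type) (phi : X -> sentence) : sentence := fun p =>
  forall x, phi x p.

Definition fex (X : Type) (phi : X -> sentence) : sentence := fun p =>
  forall q, cond_le q p -> exists2 r, cond_le r q & exists x, phi x r.

(* An absolute statement about ground-model objects. *)
Definition fground (Q : Prop) : sentence := fun=> Q.

Definition forced (phi : sentence) := forall p, phi p.

(* M stands for the name {<k, M k> : k in omega} of a subset of omega. *)
Definition set_name := nat -> malg P.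

(* E stands for the name of the sequence of sets whose n-th term is named by
   E n. *)
Definition seq_name := nat -> set_name.

(* f stands for the name of the real f(r), where r is the generic point; every
   name of a real is forced equal to one of this form. *)
Definition real_name := {mfun T >-> R}.

Definition fmem (k : nat) (M : set_name) : sentence := fun p =>
  malg_le (val p) (M k).

(* The sentence "Q(r)", r being the generic point: p forces r to lie in the
   Borel set B iff p is below the class of B.  Only used for relations Q
   defining a Borel set. *)
Definition fgeneric (Q : T -> Prop) : sentence := fun p =>
  P (rep (val p) `\` [set x | Q x]) = 0%E.

Notation "A '⋏' B" := (fand A B) (at level 80, right associativity).
Notation "A '⋎' B" := (for_ A B) (at level 85, right associativity).
Notation "A '⇒' B" := (fimp A B) (at level 95, right associativity).
Notation "A '⇔' B" := (fiff A B) (at level 95, no associativity).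
Notation "'¬' A" := (fnot A) (at level 75, right associativity).
Notation "k '∈' M" := (fmem k M) (at level 70).
Notation "'∀' x : X , A" := (fall (fun x : X => A))
  (at level 200, x name, A at level 200).
Notation "'∃' x : X , A" := (fex (fun x : X => A))
  (at level 200, x name, A at level 200).

(* nu is a name for a real-valued function on the powerset of omega, given by its
   values on names.  The sets omega, A `|` B and [set j] of the extension are
   described by membership, so the clauses apply to all of their names. *)

Definition f_finitely_additive_probability (nu : set_name -> real_name) :
    sentence :=
  (∀ A : set_name, fgeneric (fun r => 0 <= nu A r)) ⋏
  (∀ A : set_name, (∀ k : nat, k ∈ A) ⇒ fgeneric (fun r => nu A r = 1)) ⋏
  (∀ A : set_name, ∀ B : set_name, ∀ C : set_name,
     (∀ k : nat, ¬ (k ∈ A ⋏ k ∈ B)) ⋏ (∀ k : nat, (k ∈ C ⇔ k ∈ A ⋎ k ∈ B)) ⇒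
     fgeneric (fun r => nu C r = nu A r + nu B r)).

Definition f_vanishes_on_points (nu : set_name -> real_name) : sentence :=
  ∀ j : nat, ∀ A : set_name,
    (∀ k : nat, (k ∈ A ⇔ fground (k = j))) ⇒ fgeneric (fun r => nu A r = 0).

Definition f_infinite (A : set_name) : sentence :=
  ∀ m : nat, ∃ k : nat, fground (m <= k)%N ⋏ k ∈ A.

Definition f_decreasing (E : seq_name) : sentence :=
  ∀ n : nat, ∀ k : nat, (k ∈ E n.+1 ⇒ k ∈ E n).

Definition f_almost_contained (A B : set_name) : sentence :=
  ∃ m : nat, ∀ k : nat, (k ∈ A ⋏ ¬ k ∈ B ⇒ fground (k < m)%N).

Definition f_converges (u : nat -> real_name) (l : real_name) : sentence :=
  ∀ e : real_name, (fgeneric (fun r => 0 < e r) ⇒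
    ∃ N : nat, ∀ n : nat, (fground (N <= n)%N ⇒
      fgeneric (fun r => `|u n r - l r| < e r))).

Definition f_P_measure (nu : set_name -> real_name) : sentence :=
  f_finitely_additive_probability nu ⋏
  f_vanishes_on_points nu ⋏
  (∀ E : seq_name, f_decreasing E ⋏ (∀ n : nat, f_infinite (E n)) ⇒
     ∃ F : set_name, (∀ n : nat, f_almost_contained F (E n)) ⋏
                     f_converges (fun n => nu (E n)) (nu F)).

End forcing.

Section solovay.
Context d (T : measurableType d) (R : realType) (P : probability T R).
Variables (U : set_system nat) (UU : UltraFilter U).

Section ulim_measure.
Variable M : set_name P.

Let u (B : set T) (k : nat) : R := fine (P (rep (M k) `&` B)).

(* The limit along U exists for measurable B, see cvg_ulim_measure.  The proof UU
   is an argument only so that the measure instance can be inferred. *)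
Definition ulim_measure (_ : UltraFilter U) (B : set T) : \bar R :=
  (lim (fine (P (rep (M k) `&` B)) @[k --> U]))%:E.

Local Notation mu := (ulim_measure UU).

Let mMI k (B : set T) : measurable B -> measurable (rep (M k) `&` B).
Proof. by move=> mB; apply: measurableI => //; exact: measurable_rep. Qed.

Let u_ge0 B k : 0 <= u B k.
Proof. by rewrite /u fine_ge0. Qed.

Let u_le B k : measurable B -> u B k <= fine (P B).
Proof.
move=> mB; rewrite fine_le ?fin_num_measure//; first exact: mMI.
by rewrite le_measure ?inE//; exact: mMI.
Qed.

Lemma cvg_ulim_measure B : measurable B ->
  fine (P (rep (M k) `&` B)) @[k --> U] --> fine (ulim_measure UU B).
Proof.
move=> mB /=; rewrite -/(u B).
pose G : set_system R := u B @ U.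
have GU : UltraFilter G.
  split=> [|H HF GH]; first exact: fmap_proper_filter.
  apply/seteqP; split => // A HA.
  have [//|UA] := in_ultra_setVsetC (u B @^-1` A) UU.
  have : H (~` A) by apply: GH.
  move=> /(filterI HA); rewrite setICr => H0.
  by have := @filter_not_empty _ H HF.
have := @segment_compact R 0 (fine (P B)); rewrite compact_ultra => /(_ G GU).
case.
  apply: (@filterE _ U) => k /=; rewrite in_itv/= -/(u B k).
  by apply/andP; split; [exact: u_ge0|exact: u_le].
move=> l [_ /= Gl].
by apply/cvg_ex; exists l.
Qed.

Let m (B : set T) : R := lim (u B @ U).

Let m_ge0 B : 0 <= m B.
Proof.
rewrite /m; have [cu|/dvgP ->//] := pselect (cvg (u B @ U)).
by apply: limr_ge => //; apply: filterE => k; exact: u_ge0.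
Qed.

Let m_le B : measurable B -> m B <= fine (P B).
Proof.
move=> mB; apply: limr_le; first by apply: cvgP (cvg_ulim_measure mB).
by apply: filterE => k; exact: u_le.
Qed.

Let mD A B : measurable A -> measurable B -> A `&` B = set0 ->
  m (A `|` B) = m A + m B.
Proof.
move=> mA mB AB0.
apply/cvg_lim => //.
have -> : u (A `|` B) = u A \+ u B.
  apply/funext => k /=; rewrite /u setIUr measureU//.
  - by rewrite fineD// fin_num_measure//; exact: mMI.
  - exact: mMI.
  - exact: mMI.
  - by rewrite setIACA AB0 setI0.
by apply: cvgD; exact: cvg_ulim_measure.
Qed.

Let m0 : m set0 = 0.
Proof.
by have := mD measurable0 measurable0 (setI0 _); rewrite setU0 => /eqP;
  rewrite addrC -subr_eq subrr eq_sym => /eqP.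
Qed.

Lemma ulim_measure0 : mu set0 = 0%E.
Proof. by rewrite /ulim_measure -/(u set0) -/(m set0) m0. Qed.

Lemma ulim_measure_ge0 B : (0 <= mu B)%E.
Proof. by rewrite lee_fin; exact: m_ge0. Qed.

Lemma ulim_measure_sigma_additive : semi_sigma_additive mu.
Proof.
move=> F mF tF mUF.
set B := \bigcup_n F n in mUF *.
have muSA : measure_function.semi_additive mu.
  apply/measure_function.additive2P; first exact: ulim_measure0.
  by move=> X Y mX mY XY; rewrite /ulim_measure -EFinD; congr EFin; exact: mD.
pose S n := \big[setU/set0]_(i < n) F i.
have mS n : measurable (S n) by apply: bigsetU_measurable.
have mBS n : measurable (B `\` S n) by exact: measurableD.
have SB n : S n `<=` B by exact: bigsetU_bigcup.
have BE n : S n `|` (B `\` S n) = B by rewrite setDUK.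
have SBS n : S n `&` (B `\` S n) = set0 by rewrite setDIK.
have muB n : m B = \sum_(i < n) m (F i) + m (B `\` S n).
  rewrite -{1}(BE n) mD//; congr (_ + _).
  apply: EFin_inj; rewrite -[LHS]/(mu (S n)) /S muSA//; last exact: mS.
  by rewrite sumEFin.
have PB n : fine (P B) = fine (\sum_(i < n) P (F i)) + fine (P (B `\` S n)).
  rewrite -{1}(BE n) measureU// fineD ?fin_num_measure//.
  by congr (fine _ + _); rewrite /S measure_semi_additive//; exact: mS.
have cvgP : fine (\sum_(i < n) P (F i)) @[n --> \oo] --> fine (P B).
  apply: fine_cvg; rewrite fineK ?fin_num_measure//.
  have := @measure_semi_sigma_additive _ _ _ P F mF tF mUF.
  by under eq_fun do rewrite big_mkord.
apply: cvg_EFin.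
  by apply: nearW => n; rewrite sumEFin.
rewrite (_ : fine \o _ = fun n => \sum_(i < n) m (F i)); last first.
  by apply/funext => n; rewrite /= sumEFin/= big_mkord.
pose lo n := m B - (fine (P B) - fine (\sum_(i < n) P (F i))).
apply: (squeeze_cvgr (f := lo) (h := fun=> m B)).
- apply: nearW => n; rewrite /lo (muB n) (PB n).
  have h0 := m_ge0 (B `\` S n); have h1 := m_le (mBS n).
  set a := m (B `\` S n) in h0 h1 *; set b := fine (P (B `\` S n)) in h1 *.
  set x := \sum_(i < n) m (F i); set y := fine _.
  by lra.
- rewrite -[X in _ --> X]subr0 -[X in _ --> _ - X](subrr (fine (P B))).
  apply: cvgB; first exact: cvg_cst.
  by apply: cvgB => //; exact: cvg_cst.
- exact: cvg_cst.
Qed.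

HB.instance Definition _ := isMeasure.Build _ T R mu
  ulim_measure0 ulim_measure_ge0 ulim_measure_sigma_additive.

Lemma ulim_measure_fin_num : fin_num_fun mu.
Proof. by []. Qed.

HB.instance Definition _ := Measure_isFinite.Build _ T R mu ulim_measure_fin_num.

Lemma ulim_measure_dominates : mu `<< P.
Proof.
apply/null_content_dominatesP => B mB PB0.
apply/eqP; rewrite eqe eq_le -/(m B) m_ge0 andbT.
by have := m_le mB; rewrite PB0.
Qed.

End ulim_measure.

Local Open Scope charge_scope.

Definition solovay_density (M : set_name P) (r : T) : R :=
  fine ('d (charge_of_finite_measure (ulim_measure M UU)) '/d P r).

Lemma measurable_solovay_density M : measurable_fun setT (solovay_density M).
Proof.
have := fine_measurable (@measurableT _ (\bar R)).
move/measurableT_comp; apply.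
apply: measurable_int (Radon_Nikodym_integrable _).
exact: ulim_measure_dominates.
Qed.

HB.instance Definition _ M :=
  isMeasurableFun.Build _ _ T R (solovay_density M) (measurable_solovay_density M).

(* The value at M of the name of the Solovay measure: the real f_M(r). *)
Definition solovay (M : set_name P) : real_name T R := solovay_density M.

End solovay.

(* Main.v *)
Require Import Defs.
From mathcomp Require Import all_boot all_order all_algebra.
From mathcomp Require Import generic_quotient lra.
From mathcomp Require Import all_classical all_reals all_analysis.
From mathcomp Require Import measurable_realfun.
Import Order.TTheory GRing.Theory Num.Theory.
Import numFieldNormedType.Exports.

Set Implicit Arguments.
Unset Strict Implicit.
Unset Printing Implicit Defensive.

Local Open Scope classical_set_scope.
Local Open Scope ring_scope.

(** Let X_0 ⊇ X_1 ⊇ ... be sets in [U]; it suffices to find A in [U] almost contained in every X_n.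
    For a ground-model set X in [U], the measure mu attached to its check name is [P] itself
    ([ulim_measure_check]), so the Solovay measure of each X_n is almost surely 1. The P-measure
    property yields a name [F] of a pseudointersection of the X_n and a condition q forcing its
    Solovay measure to be within 1/2 of that of some X_N. The bound beyond which [F] lies inside X_n
    is random. By an Egorov argument ([exists_small_tail], [solovay_almost_contained]), off a set
    [G] covering at most half of q it can be replaced by a ground-model function t. On the remaining
    positive set [Q] the density of [F] exceeds that of X_N minus 1/2, so mu_F([Q]) ≥ P([Q])/2 > 0.
    As mu_F([Q]) is the limit along [U] of P(F(k) ∩ Q), the set A of those k with P(F(k) ∩ Q) > 0 is
    in [U]; and k in A with k ≥ t(n) must lie in X_n, since otherwise F(k) ⊆ G. *)

(** * Conditions as positive sets, and names of ground-model sets *)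

Section conditions.
Context d (T : measurableType d) (R : realType) (P : probability T R).

Lemma rep_classDl (A : set T) (mA : measurable A) :
  P (rep (malg_class P mA) `\` A) = 0%E.
Proof.
have mr := measurable_rep (malg_class P mA).
apply: (subset_measure0 _ _ _ (rep_class P mA)); first exact: measurableD.
  by rewrite setY_def; apply: measurableU; exact: measurableD.
by rewrite setY_def => x; left.
Qed.

Lemma rep_classDr (A : set T) (mA : measurable A) :
  P (A `\` rep (malg_class P mA)) = 0%E.
Proof.
have mr := measurable_rep (malg_class P mA).
apply: (subset_measure0 _ _ _ (rep_class P mA)); first exact: measurableD.
  by rewrite setY_def; apply: measurableU; exact: measurableD.
by rewrite setY_def => x; right.
Qed.

Lemma condition_rep_neq0 (p : condition P) : P (rep (val p)) <> 0%E.
Proof.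
move=> p0; case/negP: (valP p); rewrite -[val p]reprK; apply/eqP/eqmodP/asboolP.
by rewrite /= setY0.
Qed.

(** The class of [A] itself is such a condition. Used contrapositively: a measurable set is null
    once no condition lies below it. *)
Lemma exists_condition (A : set T) : measurable A -> P A <> 0%E ->
  exists p : condition P, P (rep (val p) `\` A) = 0%E.
Proof.
move=> mA PA0.
have A_neq0 : malg_class P mA != malg0 P.
  apply/eqP => A0; apply: PA0.
  have /(malg_le_class P mA measurable0) : malg_le (malg_class P mA) (malg0 P).
    by rewrite A0 /malg_le setDv measure0.
  by rewrite setD0.
exists (exist (fun a => a != malg0 P) _ A_neq0) => /=.
exact: rep_classDl.
Qed.

Lemma malg_le_trans (a b c : malg P) : malg_le a b -> malg_le b c -> malg_le a c.
Proof.
have mD (x y : malg P) : measurable (rep x `\` rep y).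
  by apply: measurableD; exact: measurable_rep.
move=> ab bc.
apply: (subset_measure0 (mD a c) (measurableU _ _ (mD a b) (mD b c))).
  by move=> x [ax cx]; have [bx|bx] := pselect (rep b x); [right|left].
exact: (null_set_setU (mD a b) (mD b c) ab bc).
Qed.

Lemma cond_le_refl (p : condition P) : cond_le p p.
Proof. by rewrite /cond_le /malg_le setDv measure0. Qed.

Definition check_name (X : set nat) : set_name P := fun k =>
  if `[< X k >] then malg_class P measurableT else malg0 P.

Lemma fmem_check (X : set nat) k (p : condition P) :
  fmem k (check_name X) p <-> X k.
Proof.
have mr (a : malg P) : measurable (rep a) := measurable_rep a.
rewrite /fmem /check_name; case: asboolP => Xk; split => //; [move=> _|move=> p0].
  apply: (subset_measure0 _ _ _ (rep_classDr measurableT)).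
  - exact: measurableD.
  - exact: measurableD.
  - exact: setSD.
exfalso; apply: (@condition_rep_neq0 p).
have m0 := rep_classDl measurable0; rewrite setD0 in m0.
have mD : measurable (rep (val p) `\` rep (malg0 P)) by exact: measurableD.
apply: (subset_measure0 _ (measurableU _ _ mD (mr _)) _
  (null_set_setU mD (mr _) p0 m0)) => //.
by move=> x px; have [?|?] := pselect (rep (malg0 P) x); [right|left].
Qed.

End conditions.

(** * The Solovay measure on check names, and its density in integrated form *)

Section solovay.
Context d (T : measurableType d) (R : realType) (P : probability T R).
Context (U : set_system nat) (UU : UltraFilter U).

(** For every k in [X] the k-th term of the limit is [P B], so the sequence is constant on a set of
    [U]. *)
Lemma ulim_measure_check X B : U X -> measurable B ->
  ulim_measure (check_name P X) UU B = P B.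
Proof.
move=> UX mB; rewrite -(fineK (fin_num_measure P _ mB)); congr EFin.
apply: (@cvg_lim R) => //; apply: cvg_near_cst.
apply: filterS UX => k Xk; rewrite /check_name (asboolT Xk); congr fine.
have mr := measurable_rep (malg_class P measurableT).
rewrite [RHS](measureDI P mB mr) setIC [X in (X + _)%E](_ : _ = 0%E) ?add0e//.
apply: (subset_measure0 _ _ _ (rep_classDr P measurableT)).
- exact: measurableD.
- exact: measurableD.
- exact: setSD.
Qed.

Lemma EFin_solovay (M : set_name P) x : (solovay UU M x)%:E =
  Radon_Nikodym (charge_of_finite_measure (ulim_measure M UU)) P x.
Proof.
rewrite -[RHS]fineK// Radon_Nikodym_fin_num//.
exact: ulim_measure_dominates.
Qed.

Lemma integrable_solovay (M : set_name P) :
  P.-integrable setT (EFin \o solovay UU M).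
Proof.
pose nu := charge_of_finite_measure (ulim_measure M UU).
have dom := @ulim_measure_dominates _ _ _ P U UU M.
apply: eq_integrable (@Radon_Nikodym_integrable _ _ _ nu _ dom) => // x _.
by rewrite /= EFin_solovay.
Qed.

Lemma solovay_ulim_measure (M : set_name P) B : measurable B ->
  ulim_measure M UU B = (\int[P]_(x in B) (solovay UU M x)%:E)%E.
Proof.
move=> mB; have dom := @ulim_measure_dominates _ _ _ P U UU M.
pose nu := charge_of_finite_measure (ulim_measure M UU).
apply: (etrans (@Radon_Nikodym_integral _ _ _ nu P B dom mB)).
by apply: eq_integral => x _; rewrite EFin_solovay.
Qed.

End solovay.

(** * Uniform bounds off a small set *)

Section egorov.
Context d (T : measurableType d) (R : realType) (P : probability T R).

(** Egorov-style: continuity from above gives [t n] making the n-th bad set smaller than e/2^(n+1)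
    inside [q], and these bounds sum to at most [e]. *)
Lemma exists_small_tail (q : set T) (G : nat -> nat -> set T) (e : R) :
  0 < e -> measurable q -> (forall n m, measurable (G n m)) ->
  (forall n, {homo G n : m k / (m <= k)%N >-> k `<=` m}) ->
  (forall n, P (q `&` \bigcap_m G n m) = 0%E) ->
  exists t : nat -> nat, (P (q `&` \bigcup_n G n (t n)) <= e%:E)%E.
Proof.
move=> e0 mq mG homG G0.
have small n : exists m, (P (q `&` G n m) <= (e / (2 ^ n.+1)%:R)%:E)%E.
  have h0 : 0 < e / (2 ^ n.+1)%:R :> R by rewrite divr_gt0// ltr0n expn_gt0.
  have mqG m : measurable (q `&` G n m) by exact: measurableI.
  have mcap : measurable (\bigcap_m (q `&` G n m)).
    by apply: bigcapT_measurable.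
  have : (P \o (fun m => q `&` G n m)) m @[m --> \oo] --> (0 : R)%:E.
    have -> : (0 : R)%:E = P (\bigcap_m (q `&` G n m)).
      by rewrite bigcapIr; [rewrite G0|exists 0%N].
    apply: nonincreasing_cvg_mu => //; first by rewrite ltey_eq fin_num_measure.
    by move=> m k mk; apply/subsetPset; exact: setIS (homG n _ _ mk).
  move=> /fine_cvg /(cvgr_lt _) /(_ _ h0) [m _ /(_ m (leqnn m))] /= Hm.
  by exists m; rewrite -[leLHS]fineK ?fin_num_measure// lee_fin ltW.
have [t tP] := choice small; exists t.
apply: le_trans (epsilon_trick0 xpredT (ltW e0)).
have mF n : measurable (q `&` G n (t n)) by exact: measurableI.
apply: (@le_trans _ _ (\sum_(0 <= n <oo) P (q `&` G n (t n)))%E); last first.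
  by apply: lee_nneseries => // n _; exact: tP.
rewrite setI_bigcupr; apply: generalized_Boole_inequality => //.
exact: bigcupT_measurable.
Qed.
End egorov.

Lemma nonprincipal_ultra_ge (U : set_system nat) : UltraFilter U ->
  nonprincipal U -> forall m, U [set k | (m <= k)%N].
Proof.
move=> UU Unp; elim=> [|m IH]; first exact: filterE.
have [/Unp//|Um] := in_ultra_setVsetC [set m] UU.
apply: filterS (filterI IH Um) => k [/= mk km].
by rewrite ltn_neqAle mk andbT; apply/eqP => mk'; apply: km; rewrite mk'.
Qed.

(** A nonempty countable family is enumerated as [Y] and replaced by its finite intersections [X n];
    an empty family admits every set as a pseudointersection. *)
Lemma P_point_of_decreasing (U : set_system nat) :
  UltraFilter U -> nonprincipal U ->
  (forall X : nat -> set nat, (forall n, U (X n)) ->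
     (forall n, X n.+1 `<=` X n) ->
     exists2 A, U A & forall n, finite_set (A `\` X n)) ->
  P_point U.
Proof.
move=> UU Unp H; split=> // C CU /pfcard_geP[->|/unsquash Y].
  by exists setT; [exact: filterT|move=> X].
pose X n := [set k | forall i, (i <= n)%N -> Y i k].
have UY i : U (Y i) by apply: CU; apply: funS.
have UX n : U (X n).
  elim: n => [|n IH].
    by apply: filterS (UY 0%N) => k Yk i; rewrite leqn0 => /eqP ->.
  apply: filterS (filterI IH (UY n.+1)) => k [Xk Yk] i.
  by rewrite leq_eqVlt => /predU1P[->//|]; exact: Xk.
have [|A UA AX] := H X UX.
  by move=> n k Xk i ni; apply: Xk; exact: leqW.
exists A => // Z CZ; have [n _ <-] := surj (f := Y) CZ.
by apply: sub_finite_set (AX n) => k [Ak Ynk]; split=> // /(_ n (leqnn n)).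
Qed.

(** * From the forced P-measure to a pseudointersection in the ground model *)

Section P_measure.
Context d (T : measurableType d) (R : realType) (P : probability T R).
Context (U : set_system nat) (UU : UltraFilter U).

(** [G n m] is the event that [F] has an element ≥ m outside [X n]. As q forces [F] to be almost
    contained in [X n], the event that this happens for all m is null inside q, so
    [exists_small_tail] applies. *)
Lemma solovay_almost_contained (q : condition P) (F : set_name P)
  (X : nat -> set nat) :
  (forall n, X n.+1 `<=` X n) ->
  (forall n, f_almost_contained F (check_name P (X n)) q) ->
  forall e : R, 0 < e -> exists t : nat -> nat,
    (P (rep (val q) `&`
        \bigcup_n \bigcup_(k in [set k | (t n <= k)%N /\ ~ X n k]) rep (F k))
      <= e%:E)%E.
Proof.
move=> Xd FX e e0.
have mr (a : malg P) : measurable (rep a) := measurable_rep a.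
pose G n m := \bigcup_(k in [set k | (m <= k)%N /\ ~ X n k]) rep (F k).
have mG n m : measurable (G n m) by exact: bigcup_measurable.
apply: (@exists_small_tail _ _ _ P (rep (val q)) G) => //.
  move=> n m k mk x [j [/= kj Xj] Fx]; exists j => //=.
  by split=> //; exact: leq_trans kj.
move=> n; set A := _ `&` _.
have mA : measurable A by apply: measurableI => //; exact: bigcapT_measurable.
apply: contrapT => /(exists_condition mA)[q1 q1A].
have q1q : cond_le q1 q.
  apply: (subset_measure0 _ _ _ q1A); [exact: measurableD|exact: measurableD|].
  by apply: setDS => x [].
(* [r] lies below [A] and decides a bound [m] for the elements of [F] outside [X n]. It will turn
   out null: almost all of it is covered by the sets F(k) with k ≥ m outside [X n], each of which
   meets it in a null set. *)
have [r rq1 [m rm]] := FX n q1 q1q.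
apply: (@condition_rep_neq0 _ _ _ _ r); apply/negligibleP => //.
have FkG : P.-negligible (\bigcup_k if (m <= k)%N && ~~ `[< X n k >] then
    rep (val r) `&` rep (F k) else set0).
  apply: negligible_bigcup => k; case: ifPn => [/andP[mk /asboolPn Xk]|_];
    last exact: negligible_set0.
  apply/negligibleP; first exact: measurableI.
  (* A condition [s] below both [r] and F(k) would force k into [F] but not into [X n], hence k <
     m. *)
  apply: contrapT => /(exists_condition (measurableI _ _ (mr _) (mr _)))[s sk].
  have msrk := measurableD (mr (val s)) (measurableI _ _ (mr (val r)) (mr (F k))).
  have sr : cond_le s r.
    apply: (subset_measure0 _ msrk _ sk); first exact: measurableD.
    by apply: setDS => x [].
  have sF : fmem k F s.
    apply: (subset_measure0 _ msrk _ sk); first exact: measurableD.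
    by apply: setDS => x [].
  have : (k < m)%N.
    apply: (rm k s sr); split => // u _ /fmem_check; exact: Xk.
  by rewrite ltnNge mk.
have rG : P (rep (val r) `\` A) = 0%E.
  have mrq1 := measurableD (mr (val r)) (mr (val q1)).
  have mq1A := measurableD (mr (val q1)) mA.
  apply: (subset_measure0 _ (measurableU _ _ mrq1 mq1A) _
    (null_set_setU mrq1 mq1A rq1 q1A)).
    exact: measurableD.
  by move=> x [rx Ax]; have [?|?] := pselect (rep (val q1) x); [right|left].
have rA : P.-negligible (rep (val r) `\` A).
  by apply/negligibleP => //; exact: measurableD.
apply: negligibleS (negligibleU FkG rA).
move=> x rx; have [[_ Gx]|Ax] := pselect (A x); last by right.
have [k [/= mk Xk] Fx] := Gx m I.
by left; exists k => //; rewrite mk (asboolF Xk).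
Qed.

Lemma ulim_measure_le (M N : set_name P) (B : set T) (e : R) : measurable B ->
  (forall x, B x -> solovay UU M x <= solovay UU N x + e) ->
  (ulim_measure M UU B <= ulim_measure N UU B + e%:E * P B)%E.
Proof.
move=> mB MN.
have int (L : set_name P) : P.-integrable B (EFin \o solovay UU L).
  exact: integrableS (integrable_solovay UU L).
have inte : P.-integrable B (EFin \o cst e).
  exact: finite_measure_integrable_cst.
rewrite !solovay_ulim_measure// -(integral_cst P mB).
rewrite -integralD//; last exact: int.
apply: le_integral => //; [exact: int|exact: (integrableD mB (int N) inte)|].
by move=> x /set_mem Bx; rewrite -EFinD lee_fin; exact: MN.
Qed.


                                                              
                                             
Lemma P_point_of_f_P_measure : nonprincipal U ->
  forced (f_P_measure (solovay UU : set_name P -> real_name T R)) -> P_point U.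
Proof.
move=> Unp HP; apply: P_point_of_decreasing => // X UX Xd.
have mr (a : malg P) : measurable (rep a) := measurable_rep a.
have PT0 : P setT <> 0%E by rewrite probability_setT; exact/eqP/oner_neq0.
have [p0 _] := exists_condition measurableT PT0.
have [_ [_ HE]] := HP p0.
pose E n := check_name P (X n).
have Edec : f_decreasing E p0.
  by move=> n k q _ /fmem_check Xk; apply/fmem_check; exact: Xd.
have Einf n : f_infinite (E n) p0.
  move=> m q qp; exists q; first exact: cond_le_refl.
  have [k [Xk mk]] := filter_ex (filterI (UX n) (nonprincipal_ultra_ge UU Unp m)).
  by exists k; split => //; apply/fmem_check.
have [q1 q1p [F [FE FC]]] :=
  HE E p0 (cond_le_refl p0) (conj Edec Einf) p0 (cond_le_refl p0).
have half_gt0 :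
    fgeneric (P := P) (fun r => 0 < (cst (2^-1) : real_name T R) r) q1.
  rewrite /fgeneric (_ : [set _ | _] = setT) ?setDT ?measure0//.
  by apply/seteqP; split => // x _ /=; rewrite invr_gt0 ltr0n.
have [q qq1 [N HN]] :=
  FC (cst (2^-1)) q1 (cond_le_refl q1) half_gt0 q1 (cond_le_refl q1).
have {HN} close := HN N q (cond_le_refl q) (leqnn N).
pose D := [set x | `|solovay UU (E N) x - solovay UU F x| < 2^-1].
have mD : measurable D.
  have ms L := @measurable_solovay_density _ _ _ P U UU L.
  have mdist : measurable_fun setT (fun x =>
      `|solovay UU (E N) x - solovay UU F x|).
    by apply: measurableT_comp => //; exact: measurable_funB (ms _) (ms _).
  rewrite -[D]setTI.
  exact: (measurable_fun_ltr mdist (measurable_cst (2^-1 : R)) measurableT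
    (Y := [set true])).
have FEq n : f_almost_contained F (E n) q.
  by move=> r rq; apply: FE; exact: malg_le_trans rq qq1.
have Pq0 : 0 < fine (P (rep (val q))).
  rewrite fine_gt0// ltey_eq fin_num_measure// andbT lt_def measure_ge0 andbT.
  exact/eqP/condition_rep_neq0.
(* Half the measure of q, so that the exceptional set cannot exhaust q. *)
have [|t Ht] := solovay_almost_contained Xd FEq (e := fine (P (rep (val q))) / 2).
  by rewrite divr_gt0.
set G := \bigcup_n _ in Ht.
have mG : measurable G.
  by apply: bigcupT_measurable => n; exact: bigcup_measurable.
pose Q := (rep (val q) `&` D) `\` G.
have mQ : measurable Q by apply: measurableD => //; exact: measurableI.
(* q is almost contained in [D], so if [Q] were null, [G] would cover almost all of q. *)
have PQ0 : (0 < P Q)%E.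
  rewrite lt_def measure_ge0 andbT; apply/eqP => PQ0.
  have mqD := measurableD (mr (val q)) mD.
  have PqG : P (rep (val q) `\` G) = 0%E.
    apply: (subset_measure0 _ _ _ (null_set_setU mQ mqD PQ0 close)).
    - exact: measurableD.
    - exact: measurableU.
    - by move=> x [qx Gx]; have [Dx|Dx] := pselect (D x); [left|right].
  move: Ht; rewrite leNgt => /negP; apply.
  have PqI : P (rep (val q)) =
      (P (rep (val q) `\` G) + P (rep (val q) `&` G))%E by exact: measureDI.
  rewrite -[ltRHS]add0e -PqG -PqI -[ltRHS]fineK ?fin_num_measure// lte_fin; lra.
(* On [Q] the densities satisfy f_{E N} ≤ f_F + 1/2; integrating gives P(Q) ≤ mu_F(Q) + P(Q)/2. *)
have FQ0 : (0 < ulim_measure F UU Q)%E.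
  have : (ulim_measure (E N) UU Q <= ulim_measure F UU Q + (2^-1)%:E * P Q)%E.
    apply: ulim_measure_le => // x [[_ Dx] _].
    by move: Dx; rewrite /D /= ltr_norml => /andP[_ /ltW]; rewrite lerBlDl addrC.
  rewrite (ulim_measure_check P UU (UX N))//.
  have := PQ0; rewrite -[P Q]fineK ?fin_num_measure// /ulim_measure.
  rewrite -EFinM -EFinD !lte_fin lee_fin; lra.
have FQ := cvgr_gt _ (cvg_ulim_measure (UU := UU) (M := F) mQ).
exists [set k | 0 < fine (P (rep (F k) `&` Q))].
  by apply: FQ; rewrite fine_gt0// FQ0 ltey.
(* If k ≥ t(n) is outside [X n], then F(k) ⊆ G pointwise, so F(k) misses [Q] altogether. *)
move=> n; apply: (sub_finite_set _ (finite_II (t n))) => k [/= FkQ Xk].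
rewrite ltnNge; apply/negP => tk; move: FkQ.
rewrite (_ : _ `&` _ = set0) ?measure0 ?ltxx//.
apply/seteqP; split => // x [Fx [_]]; apply.
by exists n => //; exists k.
Qed.

End P_measure.

Theorem theorem4p19 (R : realType) (K : choiceType)
    (K_infinite : infinite_set [set: K])
    (lam : probability (borel_two_pow K) R)
    (lam_product : standard_product_measure lam)
    (U : set_system nat) (U_ultra : UltraFilter U)
    (U_nonprincipal : nonprincipal U)
    (U_P_measure : forced (f_P_measure (@solovay _ _ _ lam U U_ultra))) :
  P_point U.
Proof. exact: (P_point_of_f_P_measure U_nonprincipal U_P_measure). Qed.
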